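(* Let $m$ be a nonnegative integer and let $T_m(x)$ be the $m$-th Chebyshev polynomial of the first kind. Then for each real $\varepsilon > 0$ there exist infinitely many positive integers $n$ such that $T_m(n) \neq 0$ and $P^+(T_m(n)) < n^{\varepsilon}$.
   Context: For a nonzero integer $k$, $P^+(k)$ denotes the largest prime factor of $k$, with the convention $P^+(\pm 1) = 1$. The Chebyshev polynomials of the first kind are defined by $T_0(x) = 1$, $T_1(x) = x$, and $T_{n+1}(x) = 2xT_n(x) - T_{n-1}(x)$ for $n \ge 1$. *)

(* Defs.v *)
From mathcomp Require Import all_boot all_order all_algebra.
From mathcomp Require Import classical_sets cardinality reals exp.

Set Implicit Arguments.
Unset Strict Implicit.
Unset Printing Implicit Defensive.

Import Order.TTheory GRing.Theory Num.Theory.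

Local Open Scope ring_scope.

Fixpoint chebyshevT (m : nat) : {poly int} :=
  match m with
  | 0%N => 1
  | 1%N => 'X
  | (m2.+1 as m1).+1 => 2%:Z *: 'X * chebyshevT m1 - chebyshevT m2
  end.

(* [max_pdiv 1 = 1], so the value at 1 and -1 is 1; the value at 0, which is
   also 1, carries no meaning. *)
Definition Pplus (k : int) : nat := max_pdiv `|k|%N.

(* Main.v *)
Require Import Defs.
From mathcomp Require Import all_boot all_order all_algebra cyclic cyclotomic mxpoly.
From mathcomp Require Import classical_sets cardinality reals exp.
From mathcomp Require Import zify ring.

Set Implicit Arguments.
Unset Strict Implicit.
Unset Printing Implicit Defensive.

Import Order.TTheory GRing.Theory Num.Theory.

Local Open Scope classical_set_scope.
Local Open Scope ring_scope.

(** For m = 0 the values are 1.  For m > 0, the integers n are taken of the form n = T_k(x), with k fixed and x large.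
    Let a be a root of a^2 - 2xa + 1, so that 2 T_j(x) = a^j + a^-j.  Then
    2 T_m(n) = a^(km) + a^-(km) = a^-(km) (a^(2km) + 1), and a^(2km) + 1 divides
    a^(4km) - 1, which is the product of the cyclotomic values Phi_d(a) over
    the divisors d of 4km.  Hence a prime dividing T_m(n) divides the norm of
    some Phi_d(a), and this norm is a nonzero integer of size
    O(x^(2 phi(d))) = O(x^(2 phi(4km))), with an implied constant that depends
    on k and m only.  Since n >= x^k, it suffices to choose k such that
    2 phi(4km) + 1 <= k eps and then to let x grow.  Such a k exists because
    phi(k) / k takes arbitrarily small positive values and phi(4km) <= 4m phi(k).

    Three devices keep the argument elementary.  The quadratic integer a is
    replaced by the integer matrix C with rows (2x, -1) and (1, 0), whose
    characteristic polynomial is X^2 - 2xX + 1; the norm of Phi_d(a) becomes the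
    determinant of Phi_d(C) ([prime_dvd_chebyshev], [det_lucas_bound]).  The
    norm, rather than the real number Phi_d(a) a^(-phi(d)/2), loses a factor 2
    in the exponent of x, which is harmless as eps is arbitrary.  Finally, the
    smallness of phi(k) / k is obtained without Euler products in
    [totient_ratio_small]: for N = M!, the identity expressing N as the sum of
    phi over the divisors of N contains the terms phi(N / i) >= phi(N) / i for
    i <= M, so phi(N) times a partial sum of the harmonic series is at most
    N. *)

(** * Euler's function takes relatively small values *)

Lemma totient_prime_mul (p d : nat) : prime p -> (0 < d)%N ->
  (totient d <= totient (p * d) <= p * totient d)%N.
Proof.
move=> p_pr d0; have p1 := prime_gt1 p_pr.
(* With d = q p^e and p not dividing q, the factor phi(q) cancels. *)
have [q copq ->] := pfactor_coprime p_pr d0.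
set e := logn p d.
have coe j : coprime q (p ^ j) by rewrite coprimeXr // coprime_sym.
rewrite mulnCA -expnS !totient_coprime // mulnCA leq_mul2l.
rewrite leq_mul2l -(orb_andr (totient q == 0)%N); apply/orP; right.
case: e => [|e].
  have -> : totient (p ^ 0) = 1%N by [].
  by rewrite expn1 totient_prime //; lia.
rewrite !totient_pfactor //= (expnS p e) [(p * (_ * _))%N]mulnCA leqnn andbT.
by rewrite leq_mul2l leq_pmull ?orbT // ltnW.
Qed.

Lemma totient_mul_bounds (a d : nat) : (0 < a)%N -> (0 < d)%N ->
  (totient d <= totient (a * d) <= a * totient d)%N.
Proof.
move=> a0 d0; elim/ltn_ind: a a0 => a IH a0.
have [->|a1] := eqVneq a 1%N; first by rewrite !mul1n leqnn.
have {}a1 : (1 < a)%N by lia.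
have p_pr := pdiv_prime a1.
have /dvdnP[b ab] := pdiv_dvd a; set p := pdiv a in p_pr ab.
have b0 : (0 < b)%N by move: a0; rewrite ab; case: (b).
have ltba : (b < a)%N by rewrite ab ltn_Pmulr // prime_gt1.
have /andP[lo hi] := IH b ltba b0.
have bd0 : (0 < b * d)%N by rewrite muln_gt0 b0.
have /andP[plo phi] := totient_prime_mul p_pr bd0.
have -> : (a * d = p * (b * d))%N by rewrite ab; lia.
rewrite (leq_trans lo plo) (leq_trans phi) //.
by rewrite ab [(b * p)%N]mulnC -mulnA leq_mul2l hi orbT.
Qed.

(** The N / i are distinct divisors of N, and the values of phi at all divisors
    of N add up to N. *)
Lemma sum_totient_quotients (n N : nat) : (0 < N)%N ->
  (forall i, (0 < i <= n)%N -> (i %| N)%N) ->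
  (\sum_(0 <= i < n) totient (N %/ i.+1) <= N)%N.
Proof.
move=> N0 dvdN.
rewrite -[leqRHS]sum_totient_dvd -(big_mkord (dvdn^~ N) totient) -[leqRHS]big_filter.
rewrite -(big_map (fun i => N %/ i.+1)%N xpredT totient).
apply: (uniq_sub_le_big leqnn (fun a b => leq_addr b a)).
- rewrite map_inj_in_uniq ?iota_uniq // => i j; rewrite !mem_index_iota /= => ilt jlt.
  have /dvdnP[a ea] : (i.+1 %| N)%N by apply: dvdN.
  have /dvdnP[b eb] : (j.+1 %| N)%N by apply: dvdN.
  rewrite {1}ea eb !mulnK // => ab; move: N0 eb; rewrite {1 2}ea ab.
  by rewrite muln_gt0 => /andP[b0 _] /eqP; rewrite eqn_pmul2l // => /eqP[].
- by rewrite filter_uniq // iota_uniq.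
- move=> d /mapP[i]; rewrite mem_index_iota => ilt ->.
  have iN : (i.+1 %| N)%N by apply: dvdN.
  by rewrite mem_filter dvdn_div // mem_index_iota ltnS leq_div.
Qed.

(** The divergence of the harmonic series in dyadic blocks: for
    2^j <= i < 2^(j+1), each of the 2^j terms phi(N / (i+1)) is at least
    phi(N) / 2^(j+1), so the block contributes at least phi(N) / 2. *)
Lemma dyadic_totient_sum (j N : nat) : (0 < N)%N ->
  (forall i, (0 < i <= 2 ^ j)%N -> (i %| N)%N) ->
  (j * totient N <= 2 * \sum_(0 <= i < 2 ^ j) totient (N %/ i.+1))%N.
Proof.
move=> N0; elim: j => [|j IH] dvdN; first by rewrite mul0n.
have le2 : (2 ^ j <= 2 ^ j.+1)%N by rewrite leq_exp2l.
rewrite (@big_cat_nat _ _ _ (2 ^ j)%N) //= mulSn addnC mulnDr leq_add //.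
  by apply: IH => i /andP[i0 ile]; apply: dvdN; rewrite i0 (leq_trans ile).
have p0 : (0 < 2 ^ j)%N by rewrite expn_gt0.
rewrite -(leq_pmul2l p0) mulnA -expnSr big_distrr /=.
have -> : (2 ^ j * totient N = \sum_(2 ^ j <= i < 2 ^ j.+1) totient N)%N.
  by rewrite sum_nat_const_nat expnS mul2n -addnn addnK.
rewrite !big_nat; apply: leq_sum => i /andP[ge lt].
have /dvdnP[q eN] : (i.+1 %| N)%N by apply: dvdN.
have q0 : (0 < q)%N by move: N0; rewrite eN; case: (q).
rewrite eN mulnK // mulnC.
have /andP[_ hi] := totient_mul_bounds (ltn0Sn i) q0.
by rewrite (leq_trans hi) // leq_mul2r lt orbT.
Qed.

(** The exponent 2c compensates the loss of 1/2 in each dyadic block. *)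
Lemma totient_ratio_small (c : nat) :
  exists2 k, (0 < k)%N & (c * totient k <= k)%N.
Proof.
exists ((2 ^ c.*2)`!); first exact: fact_gt0.
set N := _`!; have N0 : (0 < N)%N by exact: fact_gt0.
have dvdN i : (0 < i <= 2 ^ c.*2)%N -> (i %| N)%N by move=> h; exact: dvdn_fact.
have := dyadic_totient_sum N0 dvdN; have := sum_totient_quotients N0 dvdN.
by move: (\sum_(_ <= _ < _) _)%N => S; lia.
Qed.

(** * Chebyshev polynomials and power sums *)

(** The identity 2 T_n((z + 1/z) / 2) = z^n + z^-n, in a form that survives in
    any ring.  Applied twice, to C and then to C^k, it replaces the
    composition law T_m (T_k (x)) = T_(km) (x). *)
Lemma chebyshev_power_sum (A : nzRingType) (a b : A) (y : int) n :
  a * b = 1 -> b * a = 1 -> a + b = (2 * y)%:~R ->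
  a ^+ n + b ^+ n = (2 * (chebyshevT n).[y])%:~R.
Proof.
move=> ab ba s.
have H2 : forall j, a ^+ j.+2 + b ^+ j.+2 =
   (a + b) * (a ^+ j.+1 + b ^+ j.+1) - (a ^+ j + b ^+ j).
  move=> j.
  have h1 : a * b ^+ j.+1 = b ^+ j by rewrite exprS mulrA ab mul1r.
  have h2 : b * a ^+ j.+1 = a ^+ j by rewrite exprS mulrA ba mul1r.
  rewrite mulrDl !mulrDr h1 h2 -!exprS [_ ^+ j + _ ^+ j.+2]addrC addrACA.
  by rewrite [b ^+ j + _]addrC addrK.
elim/ltn_ind: n => -[|[|n]] IH.
- by rewrite !expr0 /= hornerC.
- by rewrite !expr1 /= hornerX.
rewrite H2 !IH // s -intrM -intrB; congr (_%:~R).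
by rewrite [chebyshevT n.+2]/= !hornerE /=; ring.
Qed.

(** The two bounds are proved together: the recurrence gives
    T_(n+2) - x T_(n+1) = x T_(n+1) - T_n, and the right-hand side is
    nonnegative as T_(n+1) >= x T_n >= T_n >= 0. *)
Lemma chebyshevT_growth (x : int) n : 1 <= x ->
  1 <= (chebyshevT n).[x] /\ x * (chebyshevT n).[x] <= (chebyshevT n.+1).[x].
Proof.
move=> x1; elim: n => [|n [IH1 IH2]].
  by rewrite /= hornerC hornerX mulr1.
have e : (chebyshevT n.+2).[x] = 2 * x * (chebyshevT n.+1).[x] - (chebyshevT n).[x].
  by rewrite [chebyshevT n.+2]/= !hornerE /=; ring.
rewrite e; split; nia.
Qed.

Lemma chebyshevT_ge_expr (x : int) n : 1 <= x -> x ^+ n <= (chebyshevT n).[x].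
Proof.
move=> x1; elim: n => [|n IH]; first by rewrite expr0 /= hornerC.
have [_ h] := chebyshevT_growth n x1.
by apply: le_trans h; rewrite exprS ler_wpM2l //; lia.
Qed.

(** * Norms from the companion matrix of X^2 - 2xX + 1 *)

Lemma det_mx22 (R : comNzRingType) (M : 'M[R]_2) :
  \det M = M 0 0 * M 1 1 - M 0 1 * M 1 0.
Proof.
rewrite (expand_det_row _ 0) !big_ord_recl big_ord0 /cofactor !det_mx11 !mxE /=.
rewrite addr0 /= expr0 mul1r expr1 mulN1r mulrN.
by congr (_ * M _ _ - M _ _ * M _ _); apply: val_inj.
Qed.

(** A companion matrix of X^2 - 2xX + 1, standing for x + sqrt(x^2 - 1). *)
Definition lucas_mx (x : int) : 'M[int]_2 :=
  \matrix_(i, j) (if i == 0 then (if j == 0 then 2 * x else -1)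
                  else (if j == 0 then 1 else 0)).

Lemma lucas_mx_sqr x : lucas_mx x * lucas_mx x = (2 * x) *: lucas_mx x - 1.
Proof.
apply/matrixP => i j; rewrite !mxE !big_ord_recl big_ord0 !mxE /=.
by case: i => -[|[|//]] ?; case: j => -[|[|//]] ? //=; ring.
Qed.

Lemma det_intr (z : int) : \det (z%:~R : 'M[int]_2) = z ^+ 2.
Proof. by rewrite -(rmorph_int scalar_mx) det_scalar intz. Qed.

(** Since AB = 1, A^4 - 1 = (A^2 - 1)(A^2 + 1) = (A - B) A (A + B) A, where
    A + B = 2v is scalar and (A - B)^2 = (A + B)^2 - 4 = 4v^2 - 4.  This shows
    both that v divides the determinant and that the latter does not vanish
    for v > 1. *)
Lemma det_exp4_sub1 (A B : 'M[int]_2) (v : int) : A * B = 1 -> B * A = 1 ->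
  A + B = (2 * v)%:~R ->
  exists2 c, \det (A ^+ 4 - 1) = v * c & (1 < v -> \det (A ^+ 4 - 1) != 0).
Proof.
move=> AB BA s.
have E : A ^+ 4 - 1 = (A - B) * A * ((A + B) * A).
  have -> : (A - B) * A = A ^+ 2 - 1 by rewrite mulrBl BA.
  have -> : (A + B) * A = A ^+ 2 + 1 by rewrite mulrDl BA.
  by rewrite mulrDr mulr1 mulrBl mul1r -exprD addrA subrK.
have sq : (A - B) * (A - B) = ((2 * v) ^+ 2 - 4)%:~R.
  rewrite intrB rmorphXn /= -s expr2 !mulrDl !mulrDr !mulrN !mulNr AB BA opprK.
  apply/matrixP => i j; rewrite !mxE; ring.
rewrite E !detM s det_intr.
have dA : \det A != 0.
  by apply/eqP => h; have := congr1 determinant AB; rewrite detM h mul0r det1.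
exists (\det (A - B) * \det A * (4 * v * \det A)); first by ring.
move=> v1; rewrite !mulf_neq0 ?expf_neq0 //; try lia.
apply/eqP => h; have := congr1 determinant sq; rewrite detM h mul0r det_intr.
by move/esym/eqP; rewrite expf_eq0 /=; nia.
Qed.

(** The norm of the factorization of X^N - 1 into cyclotomic polynomials. *)
Lemma det_horner_prod (x : int) (N : nat) : (0 < N)%N ->
  \prod_(d <- divisors N) \det (horner_mx (lucas_mx x) 'Phi_d)
  = \det (lucas_mx x ^+ N - 1).
Proof.
move=> N0; rewrite -(big_morph (@determinant _ 2) (@detM _ 1) (det1 _ 2)).
rewrite -rmorph_prod prod_Cyclotomic // rmorphB rmorphXn rmorph1 /=.
by rewrite horner_mx_X.
Qed.

(** With A = C^(km), [det_exp4_sub1] says that T_m(T_k(x)) divides the nonzero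
    integer det (C^(4km) - 1), the product of the det Phi_d(C); the prime p
    divides one of them, and none is zero. *)
Lemma prime_dvd_chebyshev (x : int) (k m p : nat) :
  1 < x -> (0 < k)%N -> (0 < m)%N -> prime p ->
  (p %| `|(chebyshevT m).[(chebyshevT k).[x]]|)%N ->
  exists2 d, (d %| k * m * 4)%N &
    p%:Z <= `|\det (horner_mx (lucas_mx x) 'Phi_d)|.
Proof.
move=> x1 k0 m0 p_pr pv.
set n := (chebyshevT k).[x] in pv; set v := (chebyshevT m).[n] in pv.
have n1 : 1 < n.
  apply: lt_le_trans (chebyshevT_ge_expr k (ltW x1)).
  by rewrite exprn_egt1 // -lt0n.
have v1 : 1 < v.
  apply: lt_le_trans (chebyshevT_ge_expr m (ltW n1)).
  by rewrite exprn_egt1 // -lt0n.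
(* C' is the inverse of C: it stands for the conjugate x - sqrt(x^2 - 1). *)
pose C := lucas_mx x; pose C' := (2 * x)%:~R - C.
have xC : (2 * x)%:~R * C = (2 * x) *: C by rewrite mulrzl -scaler_int intz.
have CC' : C * C' = 1.
  by rewrite mulrBr (commr_int C) xC lucas_mx_sqr opprB addrC addrNK.
have C'C : C' * C = 1 by rewrite mulrBl xC lucas_mx_sqr opprB addrC addrNK.
have comC : GRing.comm C C' by rewrite /GRing.comm CC' C'C.
have pCC' j : C ^+ j * C' ^+ j = 1 by rewrite -exprMn_comm // CC' expr1n.
have pC'C j : C' ^+ j * C ^+ j = 1.
  by rewrite -exprMn_comm ?C'C ?expr1n //; apply: commr_sym.
have sk : C ^+ k + C' ^+ k = (2 * n)%:~R.
  by apply: chebyshev_power_sum => //; rewrite addrC addrNK.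
have sm : C ^+ (k * m) + C' ^+ (k * m) = (2 * v)%:~R.
  by rewrite !exprM; apply: chebyshev_power_sum.
have [c ec nz] := det_exp4_sub1 (pCC' _) (pC'C _) sm.
have {}nz := nz v1.
have N0 : (0 < k * m * 4)%N by rewrite !muln_gt0 k0 m0.
move: ec nz; rewrite -exprM -det_horner_prod // => ec nz.
have : (p %| absz (\prod_(d <- divisors (k * m * 4))
     \det (horner_mx (lucas_mx x) 'Phi_d))%R)%N.
  by rewrite ec abszM dvdn_mulr.
rewrite (big_morph _ abszM absz1) Euclid_dvd_prod // big_has => /hasP[d dN pd].
exists d; first by rewrite dvdn_divisors.
rewrite -abszE lez_nat dvdn_leq // absz_gt0.
by apply: contraNneq nz => z; rewrite (big_rem d) //= z mul0r.
Qed.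

(** * Size of the norms *)

(** Each entry of M^(n+1) is a combination of two entries of M^n whose
    coefficients form a row of M. *)
Lemma mx_exp_bound (M : 'M[int]_2) (b : int) :
  (forall i, `|M i 0| + `|M i 1| <= b) ->
  forall n i j, `|(M ^+ n) i j| <= b ^+ n.
Proof.
move=> Mb; elim=> [|n IH] i j.
  by rewrite !expr0 mxE; case: (_ == _).
rewrite !exprS mxE !big_ord_recl big_ord0 addr0.
have -> : lift ord0 ord0 = 1 :> 'I_2 by apply: val_inj.
apply: le_trans (ler_normD _ _) _; rewrite !normrM.
have B0 : 0 <= b ^+ n := le_trans (normr_ge0 _) (IH i j).
apply: le_trans (_ : (`|M i 0| + `|M i 1|) * b ^+ n <= _).
  by rewrite mulrDl lerD // ler_wpM2l.
by rewrite ler_wpM2r.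
Qed.

Definition coef_norm1 (P : {poly int}) : int := \sum_(i < size P) `|P`_i|.

Lemma horner_mx_bound (M : 'M[int]_2) (b : int) (P : {poly int}) : 1 <= b ->
  (forall i, `|M i 0| + `|M i 1| <= b) ->
  forall i j, `|horner_mx M P i j| <= coef_norm1 P * b ^+ (size P).-1.
Proof.
move=> b1 Mb i j.
rewrite -{1}[P]coefK poly_def rmorph_sum summxE /coef_norm1 mulr_suml.
apply: le_trans (ler_norm_sum _ _ _) _; apply: ler_sum => l _.
rewrite /= horner_mxZ rmorphXn /= horner_mx_X mxE normrM ler_wpM2l //.
apply: le_trans (mx_exp_bound Mb l i j) _.
by rewrite ler_weXn2l //; case: l => l /=; lia.
Qed.

Lemma det_lucas_bound (x : int) (P : {poly int}) : 1 <= x ->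
  `|\det (horner_mx (lucas_mx x) P)| <=
    2 * (coef_norm1 P * (3 * x) ^+ (size P).-1) ^+ 2.
Proof.
move=> x1.
have Mb i : `|lucas_mx x i 0| + `|lucas_mx x i 1| <= 3 * x.
  by rewrite !mxE; case: i => -[|[|//]] ? /=; lia.
have b1 : 1 <= 3 * x by lia.
have := horner_mx_bound P b1 Mb.
move: (horner_mx _ _) (_ * _ ^+ _) => M B h.
rewrite det_mx22.
apply: le_trans (ler_normB _ _) _; rewrite !normrM.
have h00 := h 0 0; have h01 := h 0 1; have h10 := h 1 0; have h11 := h 1 1.
have -> : 2 * B ^+ 2 = B * B + B * B by ring.
by rewrite lerD // ler_pM.
Qed.

(** The point is the uniformity in x: K is the sum over d of the constants of
    [det_lucas_bound] for Phi_d, and the exponents 2 phi(d) are at most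
    2 phi(4km) as d divides 4km. *)
Lemma chebyshev_prime_bound (k m : nat) : (0 < k)%N -> (0 < m)%N ->
  exists K : nat, forall x p : nat, (1 < x)%N -> prime p ->
    (p %| `|(chebyshevT m).[(chebyshevT k).[x%:Z]]|)%N ->
    (p <= K * x ^ (2 * totient (k * m * 4)))%N.
Proof.
move=> k0 m0; set N := (k * m * 4)%N.
have N0 : (0 < N)%N by rewrite !muln_gt0 k0 m0.
pose c d := (2 * (`|coef_norm1 'Phi_d| * 3 ^ totient d) ^ 2)%N.
exists (\sum_(d <- divisors N) c d)%N => x p x1 p_pr pT.
have x1' : 1 < x%:Z by rewrite ltz_nat.
have [d dN] := prime_dvd_chebyshev x1' k0 m0 p_pr pT.
move=> /le_trans /(_ (det_lucas_bound 'Phi_d (ltW x1'))).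
rewrite size_Cyclotomic /= => pd.
have h0 : coef_norm1 'Phi_d = `|coef_norm1 'Phi_d|%N%:Z.
  by rewrite gez0_abs // sumr_ge0.
have {}pd : (p <= c d * x ^ (2 * totient d))%N.
  rewrite -lez_nat; apply: le_trans pd _.
  rewrite h0 /c; move: (absz _) (totient d) => h t.
  have -> : 2 * (h%:Z * (3 * x%:Z) ^+ t) ^+ 2 = (2 * (h * (3 * x) ^ t) ^ 2)%N%:Z.
    by rewrite -!natz natrM natrX natrM natrX natrM.
  rewrite lez_nat (expnMn 3) [(h * (_ * _))%N]mulnA expnMn mulnA.
  by rewrite [(2 * t)%N]mulnC expnM.
apply: leq_trans pd _; apply: leq_mul.
  by rewrite (big_rem d) /= ?leq_addr // -dvdn_divisors.
rewrite leq_exp2l // leq_mul2l /=.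
have /dvdnP[q eN] := dN.
have q0 : (0 < q)%N by move: N0; rewrite /N eN muln_gt0 => /andP[].
have d0 : (0 < d)%N by move: N0; rewrite /N eN muln_gt0 => /andP[].
by rewrite /N eN; have /andP[] := totient_mul_bounds q0 d0.
Qed.

(** * Choice of k and x *)

Lemma infinite_unbounded (S : set nat) :
  (forall b, exists2 n, (b < n)%N & S n) -> infinite_set S.
Proof.
move=> unb /finite_seqP[s eS].
have [n bn] := unb (\max_(i <- s) i)%N; rewrite eS /= => ns.
by move: bn; rewrite ltnNge (leq_bigmax_seq (F := id)).
Qed.

Theorem mainTheorem6 (R : realType) (m : nat) (eps : R) (heps : 0 < eps) :
  infinite_set [set n : nat |
    [/\ (0 < n)%N,
        (chebyshevT m).[n%:Z] != 0 &
        ((Pplus (chebyshevT m).[n%:Z])%:R : R) < n%:R `^ eps]].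
Proof.
apply: infinite_unbounded => b.
have [->|m0] := posnP m.
  exists b.+2; first by [].
  split; rewrite /= ?hornerC //.
  apply: le_lt_trans (_ : 1 `^ eps < _); first by rewrite powR1.
  by apply: gt0_ltr_powR; rewrite ?nnegrE ?ltr1n.
(* The exponent of x obtained below is at most 2 (4m phi(k)) + 1, hence at most
   (8m + 1) phi(k) <= c phi(k) eps <= k eps. *)
have [c ceps] : exists c : nat, (8 * m + 1)%:R <= c%:R * eps.
  exists (Num.Def.archi_bound ((8 * m + 1)%:R / eps)).
  by rewrite -ler_pdivrMr // ltW // archi_boundP // divr_ge0 // ltW.
have [k k0 ck] := totient_ratio_small c.
have [K pK] := chebyshev_prime_bound k0 m0.
(* x > K absorbs the constant K at the cost of one more factor x, and x > b
   makes n > b. *)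
pose x := (b + K + 2)%N.
have x1 : 1 <= x%:Z by rewrite lez_nat /x addn2.
have Tk1 : 1 <= (chebyshevT k).[x%:Z].
  by have [] := chebyshevT_growth k x1.
pose n := absz ((chebyshevT k).[x%:Z]).
have nE : n%:Z = (chebyshevT k).[x%:Z] by rewrite gez0_abs //; lia.
have xn : (x ^ k <= n)%N.
  rewrite -lez_nat nE; apply: le_trans (chebyshevT_ge_expr k x1).
  by rewrite -!natz natrX.
have x_le : (x <= x ^ k)%N.
  by rewrite -{1}(expn1 x) leq_pexp2l // /x addn2.
have vn : n%:Z <= (chebyshevT m).[n%:Z].
  have n1 : 1 <= n%:Z by rewrite nE.
  apply: le_trans (chebyshevT_ge_expr m n1).
  by rewrite -(prednK m0) exprS ler_peMr ?exprn_ege1.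
exists n; first by rewrite (leq_trans _ xn) // (leq_trans _ x_le) // /x; lia.
split=> /=.
- by lia.
- by lia.
have v1 : (1 < `|(chebyshevT m).[n%:Z]|)%N by lia.
have pP := max_pdiv_prime v1; have pD := max_pdiv_dvd `|(chebyshevT m).[n%:Z]|.
have x1' : (1 < x)%N by rewrite /x; lia.
have := pK x _ x1' pP; rewrite -nE => /(_ pD) hp.
rewrite /Pplus.
set D := totient (k * m * 4) in hp.
have hD : (D <= 4 * m * totient k)%N.
  have m4 : (0 < 4 * m)%N by rewrite muln_gt0.
  have /andP[_] := totient_mul_bounds m4 k0.
  by rewrite /D (_ : k * m * 4 = 4 * m * k)%N //; lia.
have tk0 : (0 < totient k)%N by rewrite totient_gt0.
have hexp : ((2 * D + 1)%:R : R) <= k%:R * eps.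
  have /(ler_wpM2r (ltW heps)) h1 : ((c * totient k)%:R : R) <= k%:R by rewrite ler_nat.
  apply: le_trans h1.
  rewrite natrM -mulrA mulrCA.
  apply: le_trans (ler_wpM2l (ler0n R (totient k)) ceps).
  by rewrite -natrM ler_nat; nia.
have hlt : (max_pdiv `|(chebyshevT m).[n%:Z]| < x ^ (2 * D + 1))%N.
  apply: leq_ltn_trans hp _.
  by rewrite addn1 expnS ltn_pmul2r ?expn_gt0; rewrite /x; lia.
apply: lt_le_trans (_ : (x ^ (2 * D + 1))%:R <= _); first by rewrite ltr_nat.
have x0R : 0 <= x%:R :> R by [].
apply: le_trans (_ : (x ^ k)%:R `^ eps <= _); last first.
  by rewrite ge0_ler_powR ?nnegrE ?ler_nat // ltW.
rewrite !natrX -!powR_mulrn // -powRrM.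
by apply: ler_powR => //; rewrite ler1n; lia.
Qed.
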